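(* Let $\mathcal{M}\subseteq\mathbb{R}^d$ be a compact embedded $C^2$-submanifold without boundary with reach $\tau_{\mathcal{M}}>0$, let $\mu$ be a Borel probability measure supported on $\mathcal{M}$, $f\in C^1(\mathbb{R}^d)$, $C=\sup_{\mathcal{T}(\tau_{\mathcal{M}})}\|\nabla f\|$, and $\eta>0$. Let $\tau\in(0,\tau_{\mathcal{M}}/2)$ and $\sigma>0$ be such that for some $\epsilon\in\big(0,\frac{\eta\tau}{2(C+\eta)}\big]$, $$\|\pi_\sigma(x)-\pi(x)\|<\epsilon,\qquad\|P_\sigma(x)-P_0(x)\|<\epsilon\qquad\text{for all }x\in\mathcal{T}(\tau).$$ Let $$\gamma_{\mathrm{tubular}}(\epsilon,\tau,\eta)=\tau\cdot\min\Big\{\frac{1}{2(C(\epsilon+2)+2\eta\tau)},\ \frac{\frac14\eta\tau-\frac12(C+\eta)\epsilon}{4(C(\epsilon+4)+3\eta\tau)^2}\Big\}.$$ If $\gamma_k\in[0,\gamma_{\mathrm{tubular}}]$ for all $k$ and $x_0\in\mathcal{T}(\tau)$, then all iterates of $x_{k+1}=x_k-\gamma_k\nabla F_\sigma^\eta(x_k)$ belong to $\mathcal{T}(\tau)$.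
   Context: Reach $\tau_{\mathcal{M}}$: largest $\tau\ge0$ such that $(p,v)\mapsto p+v$ on $\{(p,v):p\in\mathcal{M},v\in N_p\mathcal{M},\|v\|<\tau\}$ is a diffeomorphism onto its image; $\mathcal{T}(\tau)=\{p+v:p\in\mathcal{M},v\in N_p\mathcal{M},\|v\|<\tau\}$; $\pi(x)$ is the unique closest point of $\mathcal{M}$ to $x$, $P_0(x)=\pi'(x)$ its Jacobian. With $p_\sigma$ the density of $\mathcal{N}(0,\sigma^2I)*\mu$: $\mathrm{d}_\sigma(x)=-\sigma^2\log p_\sigma(x)$, $\pi_\sigma(x)=x+\sigma^2\nabla\log p_\sigma(x)$, $P_\sigma(x)=I+\sigma^2\nabla^2\log p_\sigma(x)$, and $F_\sigma^\eta(x)=f(\pi_\sigma(x))+\eta\,\mathrm{d}_\sigma(x)$. *)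

(* Defs.v *)
From HB Require Import structures.
From mathcomp Require Import all_boot all_order all_algebra.
From mathcomp Require Import all_classical all_reals all_analysis.
Set Implicit Arguments. Unset Strict Implicit. Unset Printing Implicit Defensive.
Import Order.TTheory GRing.Theory Num.Theory.
Import numFieldNormedType.Exports.
Local Open Scope classical_set_scope.
Local Open Scope ring_scope.

Definition dotv {R : realType} {d : nat} (u v : 'rV[R]_d) : R :=
  \sum_i u 0 i * v 0 i.
(* Euclidean norm (the library norm on matrices is the sup norm) *)
Definition enorm {R : realType} {d : nat} (v : 'rV[R]_d) : R :=
  Num.sqrt (dotv v v).
(* operator (spectral) norm of a d x d matrix acting on column vectors *)
Definition opnorm {R : realType} {d : nat} (A : 'M[R]_d) : R :=
  sup [set enorm (v *m A^T) | v in [set v : 'rV[R]_d | enorm v <= 1]].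

Definition evec {R : realType} {d : nat} (i : 'I_d) : 'rV[R]_d := delta_mx 0 i.
Definition partial {R : realType} {d : nat} (i : 'I_d) (g : 'rV[R]_d -> R)
  (x : 'rV[R]_d) : R := 'D_(evec i) g x.
Definition grad {R : realType} {d : nat} (g : 'rV[R]_d -> R) (x : 'rV[R]_d)
  : 'rV[R]_d := \row_i partial i g x.
Definition jacobian {R : realType} {d k : nat} (F : 'rV[R]_d -> 'rV[R]_k)
  (x : 'rV[R]_d) : 'M[R]_(k, d) :=
  \matrix_(i, j) partial j (fun y => F y 0 i) x.
Definition hessian {R : realType} {d : nat} (g : 'rV[R]_d -> R) (x : 'rV[R]_d)
  : 'M[R]_d := \matrix_(i, j) partial j (partial i g) x.

Definition C1_on {R : realType} {d : nat} (U : set 'rV[R]_d) (g : 'rV[R]_d -> R) :=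
  (forall x, U x -> differentiable g x) /\
  (forall i x, U x -> {for x, continuous (partial i g)}).
Definition C2_on {R : realType} {d : nat} (U : set 'rV[R]_d) (g : 'rV[R]_d -> R) :=
  C1_on U g /\ forall i, C1_on U (partial i g).
Definition C1_on_vec {R : realType} {d k : nat} (U : set 'rV[R]_d)
  (F : 'rV[R]_d -> 'rV[R]_k) := forall i, C1_on U (fun y => F y 0 i).
Definition C2_on_vec {R : realType} {d k : nat} (U : set 'rV[R]_d)
  (F : 'rV[R]_d -> 'rV[R]_k) := forall i, C2_on U (fun y => F y 0 i).

Definition C2_submanifold {R : realType} {d : nat} (M : set 'rV[R]_d) : Prop :=
  forall p, M p ->
  exists (k : nat) (U : set 'rV[R]_d) (Phi : 'rV[R]_d -> 'rV[R]_k),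
    [/\ open U, U p, C2_on_vec U Phi,
        (forall x, U x -> \rank (jacobian Phi x) = k) &
        M `&` U = U `&` [set x | Phi x = 0]].

Definition tangent_space {R : realType} {d : nat} (M : set 'rV[R]_d)
  (p : 'rV[R]_d) : set 'rV[R]_d :=
  [set v | exists (c : R -> 'rV[R]_d) (e : R), [/\ 0 < e,
      (forall t, `|t| < e -> M (c t)), c 0 = p, differentiable c 0 &
      'D_1 c 0 = v]].
Definition normal_space {R : realType} {d : nat} (M : set 'rV[R]_d)
  (p : 'rV[R]_d) : set 'rV[R]_d :=
  [set v | forall w, tangent_space M p w -> dotv v w = 0].

Definition normal_bundle {R : realType} {d : nat} (M : set 'rV[R]_d)
  (r : \bar R) : set ('rV[R]_d * 'rV[R]_d) :=
  [set pv | [/\ M pv.1, normal_space M pv.1 pv.2 & ((enorm pv.2)%:E < r)%E]].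
Definition tube {R : realType} {d : nat} (M : set 'rV[R]_d) (r : \bar R)
  : set 'rV[R]_d := [set pv.1 + pv.2 | pv in normal_bundle M r].

(* (p,v) |-> p + v is a (C^1) diffeomorphism from the normal bundle of
   radius r onto its image: injective, open image, and C^1 inverse *)
Definition normal_map_diffeo {R : realType} {d : nat} (M : set 'rV[R]_d)
  (r : \bar R) : Prop :=
  [/\ (forall a b, normal_bundle M r a -> normal_bundle M r b ->
          a.1 + a.2 = b.1 + b.2 -> a = b),
      open (tube M r) &
      exists gp gv : 'rV[R]_d -> 'rV[R]_d,
        [/\ (forall x, tube M r x -> normal_bundle M r (gp x, gv x)
                                    /\ gp x + gv x = x),
            C1_on_vec (tube M r) gp & C1_on_vec (tube M r) gv]].

Definition reach {R : realType} {d : nat} (M : set 'rV[R]_d) : \bar R :=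
  ereal_sup [set r%:E | r in [set r : R | 0 <= r /\ normal_map_diffeo M r%:E]].

Definition closest_point {R : realType} {d : nat} (M : set 'rV[R]_d)
  (x : 'rV[R]_d) : 'rV[R]_d :=
  xget 0 [set p | M p /\ forall q, M q -> enorm (x - p) <= enorm (x - q)].
Definition P0 {R : realType} {d : nat} (M : set 'rV[R]_d) (x : 'rV[R]_d)
  : 'M[R]_d := jacobian (closest_point M) x.

Definition borelV (R : realType) (d : nat) :=
  g_sigma_algebraType (@open 'rV[R]_d).

Definition gauss {R : realType} {d : nat} (sigma : R) (v : 'rV[R]_d) : R :=
  (Num.sqrt (2 * pi) * sigma) ^- d * expR (- (enorm v ^+ 2) / (2 * sigma ^+ 2)).

(* p_sigma = density of N(0, sigma^2 I) * mu *)
Definition p_sigma {R : realType} {d : nat}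
  (mu : probability (borelV R d) R) (sigma : R) (x : 'rV[R]_d) : R :=
  fine (\int[mu]_(y in setT) (gauss sigma (x - (y : 'rV[R]_d)))%:E)%E.

Definition d_sigma {R : realType} {d : nat}
  (mu : probability (borelV R d) R) (sigma : R) (x : 'rV[R]_d) : R :=
  - sigma ^+ 2 * ln (p_sigma mu sigma x).
Definition pi_sigma {R : realType} {d : nat}
  (mu : probability (borelV R d) R) (sigma : R) (x : 'rV[R]_d) : 'rV[R]_d :=
  x + sigma ^+ 2 *: grad (fun y => ln (p_sigma mu sigma y)) x.
Definition P_sigma {R : realType} {d : nat}
  (mu : probability (borelV R d) R) (sigma : R) (x : 'rV[R]_d) : 'M[R]_d :=
  1%:M + sigma ^+ 2 *: hessian (fun y => ln (p_sigma mu sigma y)) x.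
Definition F_sigma_eta {R : realType} {d : nat}
  (mu : probability (borelV R d) R) (f : 'rV[R]_d -> R) (sigma eta : R)
  (x : 'rV[R]_d) : R :=
  f (pi_sigma mu sigma x) + eta * d_sigma mu sigma x.

Definition gamma_tubular {R : realType} (C eps tau eta : R) : R :=
  tau * Num.min (1 / (2 * (C * (eps + 2) + 2 * eta * tau)))
                ((eta * tau / 4 - (C + eta) * eps / 2) /
                 (4 * (C * (eps + 4) + 3 * eta * tau) ^+ 2)).

(* Main.v *)
(** Write pi for the closest-point map and let x lie in the tube of radius tau,
    p = pi(x), u = x - p, r = |u|.  Since pi(x) belongs to M, the distance of
    x - gamma G to M is at most |u - gamma G|, so it suffices to bound the latter
    by tau, where G = P_sigma^T grad f(pi_sigma(x)) + eta (x - pi_sigma(x)) is the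
    gradient of F.
    The map pi is constant along normal segments, hence P_0 u = 0 and
    <u, G> >= r (eta r - (C + eta) eps).  It is 2-Lipschitz on the tube, because
    the points p + 2u still project to p (Federer), hence |P_0| <= 2 and
    |G| <= C (eps + 2) + eta (r + eps).
    If r < tau/2, the first bound on gamma gives |gamma G| <= tau/2; otherwise
    expanding |u - gamma G|^2 and using the second bound gives |u - gamma G| <= r. *)

Require Import Defs.
From HB Require Import structures.
From mathcomp Require Import all_boot all_order all_algebra.
From mathcomp Require Import all_classical all_reals all_analysis.
From mathcomp Require Import measurable_realfun ring lra.
Import Order.TTheory GRing.Theory Num.Theory.
Import numFieldNormedType.Exports.
Local Open Scope classical_set_scope.
Local Open Scope ring_scope.

(** * Euclidean norm *)

Section Euclid.
Context {R : realType} {d : nat}.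
Implicit Types (u v w : 'rV[R]_d) (a : R) (A : 'M[R]_d).

Lemma dotvC u v : dotv u v = dotv v u.
Proof. by apply: eq_bigr => i _; rewrite mulrC. Qed.

Lemma dotvDl u v w : dotv (u + v) w = dotv u w + dotv v w.
Proof. by rewrite /dotv -big_split; apply: eq_bigr => i _; rewrite !mxE mulrDl. Qed.

Lemma dotvDr u v w : dotv u (v + w) = dotv u v + dotv u w.
Proof. by rewrite dotvC dotvDl !(dotvC u). Qed.

Lemma dotvZl a u v : dotv (a *: u) v = a * dotv u v.
Proof. by rewrite /dotv mulr_sumr; apply: eq_bigr => i _; rewrite !mxE mulrA. Qed.

Lemma dotvZr a u v : dotv u (a *: v) = a * dotv u v.
Proof. by rewrite dotvC dotvZl dotvC. Qed.

Lemma dotvNl u v : dotv (- u) v = - dotv u v.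
Proof. by rewrite -scaleN1r dotvZl mulN1r. Qed.

Lemma dotvNr u v : dotv u (- v) = - dotv u v.
Proof. by rewrite dotvC dotvNl dotvC. Qed.

Definition dotvE := (dotvDl, dotvDr, dotvNl, dotvNr, dotvZl, dotvZr).

Lemma dotv0l v : dotv 0 v = 0.
Proof. by rewrite -(scale0r 0) dotvZl mul0r. Qed.

Lemma dotv_ge0 u : 0 <= dotv u u.
Proof. by apply: sumr_ge0 => i _; rewrite -expr2 sqr_ge0. Qed.

Lemma dotv_eq0 u : dotv u u = 0 -> u = 0.
Proof.
move=> /eqP; rewrite psumr_eq0 => [/allP u0|i _]; last by rewrite -expr2 sqr_ge0.
apply/rowP => i; have := u0 i (mem_index_enum _).
by rewrite -expr2 sqrf_eq0 mxE => /eqP.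
Qed.

(** Adjunction in row-vector form: [u *m A^T] is $Au$ written as a row, and [v *m A] is $A^Tv$. *)
Lemma dotv_mulmx u v A : dotv (u *m A^T) v = dotv u (v *m A).
Proof.
rewrite /dotv; under eq_bigr do rewrite mxE mulr_suml.
rewrite exchange_big; apply: eq_bigr => j _.
rewrite mxE mulr_sumr; apply: eq_bigr => i _.
by rewrite mxE; ring.
Qed.

Lemma enorm_ge0 u : 0 <= enorm u. Proof. exact: sqrtr_ge0. Qed.

Lemma sqr_enorm u : enorm u ^+ 2 = dotv u u.
Proof. by rewrite sqr_sqrtr// dotv_ge0. Qed.

Lemma enorm_eq0 u : enorm u = 0 -> u = 0.
Proof. by move=> u0; apply: dotv_eq0; rewrite -sqr_enorm u0 expr0n. Qed.

Lemma enorm0 : enorm (0 : 'rV[R]_d) = 0.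
Proof. by rewrite /enorm dotv0l sqrtr0. Qed.

Lemma enormZ a u : enorm (a *: u) = `|a| * enorm u.
Proof. by rewrite /enorm !dotvE mulrA -expr2 sqrtrM ?sqr_ge0// sqrtr_sqr. Qed.

Lemma enormN u : enorm (- u) = enorm u.
Proof. by rewrite -scaleN1r enormZ normrN1 mul1r. Qed.

Lemma enormC u v : enorm (u - v) = enorm (v - u).
Proof. by rewrite -opprB enormN. Qed.

Lemma cauchy_schwarz u v : dotv u v <= enorm u * enorm v.
Proof.
have [v0|v_neq0] := eqVneq (enorm v) 0.
  by rewrite (enorm_eq0 _ v0) dotvC dotv0l enorm0 mulr0.
have v_gt0 : 0 < enorm v by rewrite lt_neqAle eq_sym v_neq0 enorm_ge0.
(* This vector is $\|v\|^2$ times the component of [u] orthogonal to [v], scaled so that no division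
   occurs. *)
have := dotv_ge0 (enorm v ^+ 2 *: u - dotv u v *: v).
rewrite !dotvE (dotvC v u) -!sqr_enorm => uv.
have {uv} : 0 <= enorm v ^+ 2 * ((enorm u * enorm v) ^+ 2 - dotv u v ^+ 2).
  by rewrite (le_trans uv)// le_eqVlt; apply/orP; left; apply/eqP; ring.
rewrite pmulr_rge0 ?exprn_gt0// subr_ge0 => uv.
have [|] := lerP (dotv u v) 0; first by move/le_trans; apply; rewrite mulr_ge0 ?enorm_ge0.
by move=> /ltW uv0; rewrite -(@ler_pXn2r _ 2) ?nnegrE ?mulr_ge0 ?enorm_ge0.
Qed.

Lemma ler_norm_dotv u v : `|dotv u v| <= enorm u * enorm v.
Proof.
by rewrite ler_norml lerNl -dotvNl (le_trans (cauchy_schwarz _ _)) ?enormN ?cauchy_schwarz.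
Qed.

Lemma ler_enormD u v : enorm (u + v) <= enorm u + enorm v.
Proof.
rewrite -(@ler_pXn2r _ 2) ?nnegrE ?addr_ge0 ?enorm_ge0// sqr_enorm !dotvE.
rewrite -!sqr_enorm (dotvC v u); have := cauchy_schwarz u v; lra.
Qed.

Lemma ler_enormB u v : enorm (u - v) <= enorm u + enorm v.
Proof. by rewrite (le_trans (ler_enormD _ _))// enormN. Qed.

Lemma ler_coord_enorm u i : `|u 0 i| <= enorm u.
Proof.
rewrite -(@ler_pXn2r _ 2) ?nnegrE ?enorm_ge0// sqr_enorm real_normK ?num_real//.
rewrite /dotv (bigD1 i)//= -expr2 lerDl; apply: sumr_ge0 => j _.
by rewrite -expr2 sqr_ge0.
Qed.

Lemma ler_enorm_sum u : enorm u <= \sum_i `|u 0 i|.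
Proof.
rewrite -(@ler_pXn2r _ 2) ?nnegrE ?enorm_ge0 ?sumr_ge0// sqr_enorm expr2 mulr_suml.
apply: ler_sum => i _; rewrite -expr2 -real_normK ?num_real// expr2.
by rewrite ler_wpM2l// (bigD1 i)//= lerDl sumr_ge0.
Qed.

(** Test with [v = u] and cancel one factor. Norm bounds on derivative vectors thereby reduce to
    scalar functions. *)
Lemma enorm_ler_dotv u a : 0 <= a -> (forall v, dotv u v <= a * enorm v) ->
  enorm u <= a.
Proof.
move=> a0 /(_ u); rewrite -sqr_enorm expr2.
have [->//|u0] := eqVneq (enorm u) 0.
by rewrite ler_pM2r// lt_neqAle eq_sym u0 enorm_ge0.
Qed.

(** A crude bound showing that the set under the [sup] of [opnorm] is bounded above, so that the
    supremum is a genuine upper bound. *)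
Lemma mulmx_enorm_bounded A u : enorm u <= 1 ->
  enorm (u *m A^T) <= \sum_i \sum_j `|A i j|.
Proof.
move=> u1; rewrite (le_trans (ler_enorm_sum _))//; apply: ler_sum => i _.
rewrite mxE (le_trans (ler_norm_sum _ _ _))//; apply: ler_sum => j _.
by rewrite mxE normrM ler_piMl// (le_trans (ler_coord_enorm _ _)).
Qed.

Lemma opnorm_ub A u : enorm (u *m A^T) <= opnorm A * enorm u.
Proof.
have [u0|u_neq0] := eqVneq (enorm u) 0.
  by rewrite (enorm_eq0 _ u0) mul0mx enorm0 mulr0.
have u_gt0 : 0 < enorm u by rewrite lt_neqAle eq_sym u_neq0 enorm_ge0.
pose v := (enorm u)^-1 *: u.
have v1 : enorm v = 1 by rewrite enormZ gtr0_norm ?invr_gt0// mulVf.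
suff : enorm (v *m A^T) <= opnorm A.
  by rewrite -scalemxAl enormZ gtr0_norm ?invr_gt0// mulrC ler_pdivrMr.
apply: ub_le_sup; last by exists v => //=; rewrite v1.
exists (\sum_i \sum_j `|A i j|) => _ [w /= w1 <-]; exact: mulmx_enorm_bounded.
Qed.

End Euclid.

(** * Directional derivatives *)

Section Derivatives.
Context {R : realType}.

(** Both difference quotients are the same function of the increment; directional derivatives become
    one-variable ones. *)
Lemma is_derive_line {V : normedModType R} (g : V -> R) (x v : V) (t l : R) :
  is_derive t 1 (fun s : R => g (x + s *: v)) l <-> is_derive (x + t *: v) v g l.
Proof.
have E : (fun h : R => h^-1 *: (((fun s : R => g (x + s *: v)) \o shift t) (h *: (1 : R))
      - g (x + t *: v))) =
    (fun h : R => h^-1 *: ((g \o shift (x + t *: v)) (h *: v) - g (x + t *: v))).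
  apply/funext => h /=; congr (_ *: (g _ - _)).
  by rewrite [h *: _]mulr1 scalerDl addrCA.
split=> -[dg <-]; split.
- by move: dg; rewrite /derivable E.
- by rewrite /derive E.
- by rewrite /derivable E.
- by rewrite /derive E.
Qed.

Lemma is_derive_line0 {V : normedModType R} (g : V -> R) (x v : V) (l : R) :
  is_derive (0 : R) 1 (fun s : R => g (x + s *: v)) l <-> is_derive x v g l.
Proof. by rewrite is_derive_line scale0r addr0. Qed.

Lemma is_derive_le (h : R -> R) (l K : R) : is_derive (0 : R) 1 h l ->
  (\forall t \near 0, `|h t - h 0| <= K * `|t|) -> `|l| <= K.
Proof.
move=> [dh <-] hK.
have cv : (fun t : R => `|t^-1 *: ((h \o shift 0) (t *: (1 : R)) - h 0)|) @ 0^' --> `|'D_1 h 0|.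
  exact: cvg_norm.
apply: (ler_cvg_to cv (cvg_cst K)).
near=> t.
have t0 : t != 0 by near: t; exact: nbhs_dnbhs_neq.
rewrite /= addr0 [t *: _]mulr1 normrM normfV ler_pdivrMl ?normr_gt0// mulrC.
by near: t; exact: nbhs_dnbhs.
Unshelve. all: by end_near. Qed.

Lemma is_derive_ge0 (h : R -> R) (l e : R) : is_derive (0 : R) 1 h l ->
  0 < e -> (forall t, `|t| < e -> h 0 <= h t) -> 0 <= l.
Proof.
move=> [dh <-] e0 h0.
have cv : (fun t : R => t^-1 *: ((h \o shift 0) (t *: (1 : R)) - h 0)) @ 0^'+ --> 'D_1 h 0.
  exact: (cvg_dnbhs_at_right dh).
apply: (ler_cvg_to (cvg_cst 0) cv).
near=> t.
have t0 : 0 < t by [].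
rewrite /= addr0 [t *: _]mulr1; apply: mulr_ge0; first by rewrite invr_ge0 ltW.
rewrite subr_ge0; apply: h0; rewrite gtr0_norm//; near: t; exact: nbhs_right_lt.
Unshelve. all: by end_near. Qed.

(** Fermat's rule: quotients from the right give [0 <= l], and the reflected function [h (- t)]
    gives [0 <= - l]. *)
Lemma is_derive_min0 (h : R -> R) (l e : R) : is_derive (0 : R) 1 h l ->
  0 < e -> (forall t, `|t| < e -> h 0 <= h t) -> l = 0.
Proof.
move=> dh e0 h0; apply/eqP; rewrite eq_le; apply/andP; split; last first.
  exact: is_derive_ge0 dh e0 h0.
rewrite -oppr_ge0; apply: (@is_derive_ge0 (fun t => h (- t)) _ e) => // [|t te].
  have : is_derive (0 : R) 1 (h \o -%R) (l * (-1)).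
    by apply: is_derive1_comp; rewrite oppr0.
  by rewrite mulrN1.
by rewrite oppr0 h0// normrN.
Qed.

(** The inner map is restricted to the line through [x] along [v]; a curve derivable at 0 is
    differentiable there, so directional derivatives of the coordinates of [g] suffice. *)
Lemma is_derive_chain {m n : nat} (f : 'rV[R]_n -> R) (g : 'rV[R]_m -> 'rV[R]_n)
    (x v : 'rV[R]_m) (l : 'rV[R]_n) :
  differentiable f (g x) -> (forall i, is_derive x v (fun y => g y 0 i) (l 0 i)) ->
  is_derive x v (f \o g) (dotv (grad f (g x)) l).
Proof.
move=> df dg; apply/is_derive_line0.
pose c (s : R) := g (x + s *: v).
have c0 : c 0 = g x by rewrite /c scale0r addr0.
have dc : derivable c 0 1.
  apply/derivable_mxP => i j; rewrite ord1.
  by have /is_derive_line0[] := dg j.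
have c'0 : 'D_1 c 0 = l.
  rewrite derive_mx//; apply/rowP => j; rewrite mxE.
  by have /is_derive_line0[_ <-] := dg j.
have dfc : differentiable f (c 0) by rewrite c0.
have {}dc : differentiable c 0 by apply/derivable1_diffP.
have dfoc : differentiable (f \o c) 0 by exact: differentiable_comp.
split; first exact: diff_derivable.
rewrite (_ : (fun _ => _) = f \o c)// (deriveE _ dfoc) (diff_comp dc dfc) /= -(deriveE _ dc) c'0 c0.
rewrite [X in 'd _ _ X](row_sum_delta l) linear_sum; apply: eq_bigr => i _.
by rewrite linearZ /= mulrC mxE /partial deriveE.
Qed.

Lemma is_derive_coord {m : nat} (x v : 'rV[R]_m) i :
  is_derive x v (fun y : 'rV[R]_m => y 0 i) (v 0 i).
Proof.
have dv : derivable (@id 'rV[R]_m) x v by exact: derivable_id.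
split; first exact: (derivable_mxP _ _ _).1.
by have := derive_mx dv; rewrite derive_id => /rowP /(_ i); rewrite mxE.
Qed.

Lemma is_derive_diff {m : nat} (f : 'rV[R]_m -> R) (x v : 'rV[R]_m) :
  differentiable f x -> is_derive x v f (dotv (grad f x) v).
Proof.
by move=> df; apply: (@is_derive_chain _ _ f id) => // i; exact: is_derive_coord.
Qed.

Lemma is_derive_comp_real {V : normedModType R} (f : R -> R) (g : V -> R)
    (x v : V) (a b : R) :
  is_derive (g x) 1 f a -> is_derive x v g b -> is_derive x v (f \o g) (a * b).
Proof.
move=> df /is_derive_line0 dg; apply/is_derive_line0.
by apply: (is_derive1_comp _ dg); rewrite scale0r addr0.
Qed.

End Derivatives.

(** * Closest points and tubes *)

Section Norm.
Context {R : realType} {d : nat}.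

Lemma dotv_continuous : continuous (fun u : 'rV[R]_d => dotv u u).
Proof.
have cc i : continuous (fun u : 'rV[R]_d => u 0 i) by exact: coord_continuous.
apply: continuous_big => [|i _]; first exact: add_continuous.
by move=> u; exact: (continuousM (cc i u) (cc i u)).
Qed.

Lemma enorm_continuous : continuous (@enorm R d).
Proof.
move=> u; apply: (@continuous_comp _ _ _ (fun v : 'rV[R]_d => dotv v v)).
  exact: dotv_continuous.
exact: sqrt_continuous.
Qed.

End Norm.

Section ClosestPoint.
Context {R : realType} {d : nat}.
Variable M : set 'rV[R]_d.
Hypothesis cM : compact M.
Implicit Types (p q u v x : 'rV[R]_d).

(** The distance to [x] attains its minimum on the compact set [M], so [xget] returns a minimizer
    and never its default 0. *)
Lemma closest_pointP x : M !=set0 ->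
  M (closest_point M x) /\
  forall q, M q -> enorm (x - closest_point M x) <= enorm (x - q).
Proof.
move=> M0.
have [|p /set_mem Mp pmin] := @compact_EVT_min _ _ (fun q => enorm (x - q)) _ M0 cM.
  apply: continuous_subspaceT => q.
  apply: (@continuous_comp _ _ _ (fun q => x - q)); last exact: enorm_continuous.
  by apply: continuousB => //; exact: cst_continuous.
apply: (@xgetPex _ 0 [set p | M p /\ forall q, M q -> enorm (x - p) <= enorm (x - q)]).
by exists p; split=> // q Mq; exact/pmin/mem_set.
Qed.

(** Along a curve in [M] through [p] with velocity [w], the squared distance to [x] is minimal at
    time 0, where its derivative is $-2\langle x-p,w\rangle$. *)
Lemma minimizer_normal x p : M p -> (forall q, M q -> enorm (x - p) <= enorm (x - q)) ->
  Defs.normal_space M p (x - p).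
Proof.
move=> Mp pmin w [c [e [e0 Mc c0 dc c'0]]].
pose h (t : R) := \sum_i (x 0 i - c t 0 i) ^+ 2.
have hE t : h t = enorm (x - c t) ^+ 2.
  by rewrite sqr_enorm; apply: eq_bigr => i _; rewrite !mxE expr2.
have dci i : is_derive (0 : R) 1 (fun t => c t 0 i) (w 0 i).
  have dc1 : derivable c 0 1 by exact: diff_derivable.
  split; first exact: (derivable_mxP _ _ _).1.
  by have := derive_mx dc1; rewrite c'0 => /rowP /(_ i); rewrite mxE.
have dh : is_derive (0 : R) 1 h (- 2 * dotv (x - p) w).
    pose g i := (cst (x 0 i) - (fun t => c t 0 i) : R -> R) ^+ 2.
  have -> : h = \sum_i g i.
    by apply/funext => t; rewrite fct_sumE; apply: eq_bigr => i _; rewrite /g !fctE.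
  have dg i : is_derive (0 : R) 1 (g i) (- 2 * ((x - p) 0 i * w 0 i)).
    apply: is_derive_eq; rewrite !fctE c0 !mxE.
    by rewrite /GRing.scale /=; ring.
  apply: is_derive_eq; rewrite /dotv mulr_sumr; exact: eq_bigr.
have := is_derive_min0 _ _ _ dh e0.
have h0 t : `|t| < e -> h 0 <= h t.
  by move=> te; rewrite !hE c0 ler_pXn2r ?nnegrE ?enorm_ge0//; apply/pmin/Mc.
move=> /(_ h0) /eqP; rewrite mulf_eq0 oppr_eq0 pnatr_eq0 /=.
by move=> /eqP.
Qed.

(** A closest point is the foot of a normal, and it is at least as near as any given point of [M].
    Membership in a tube then only asks for some nearby point of [M]. *)
Lemma tubeP (r : \bar R) x :
  tube M r x <-> exists p, M p /\ ((enorm (x - p))%:E < r)%E.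
Proof.
split=> [[[p v]] [/= Mp _ vr] <-|[p [Mp pr]]].
  by exists p; split=> //; rewrite addrAC subrr add0r.
have [Mq qmin] := closest_pointP x (ex_intro _ p Mp).
exists (closest_point M x, x - closest_point M x); last by rewrite /= addrC subrK.
split=> //=; first exact: minimizer_normal.
by rewrite (le_lt_trans _ pr)// lee_fin qmin.
Qed.

Lemma normal_spaceZ p v (a : R) : Defs.normal_space M p v -> Defs.normal_space M p (a *: v).
Proof. by move=> nv w /nv vw; rewrite dotvZl vw mulr0. Qed.

(** With [q] the closest point to [p + v], the pairs [(q, p + v - q)] and [(p, v)] both lie in the
    normal bundle of radius [r], since $\|p+v-q\|\le\|v\|$. They have the same sum, so injectivity
    identifies them. *)
Lemma closest_point_normal (r : \bar R) p v : normal_map_diffeo M r ->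
  M p -> Defs.normal_space M p v -> ((enorm v)%:E < r)%E -> closest_point M (p + v) = p.
Proof.
move=> [inj _ _] Mp nv vr.
have [Mq qmin] := closest_pointP (p + v) (ex_intro _ p Mp).
set q := closest_point M (p + v) in Mq qmin *.
suff [] : (q, p + v - q) = (p, v) by [].
apply: inj => /=; last by rewrite addrC subrK.
- split=> //=; first exact: minimizer_normal.
  by rewrite (le_lt_trans _ vr)// lee_fin (le_trans (qmin _ Mp))// addrAC subrr add0r.
- by [].
Qed.

End ClosestPoint.

(** * The projection and its Jacobian *)

Section Projection.
Context {R : realType} {d : nat}.
Variables (M : set 'rV[R]_d) (r tau : R).
Hypotheses (cM : compact M) (Mr : normal_map_diffeo M r%:E) (tau_r : 2 * tau < r).
Implicit Types (p q u v w x y : 'rV[R]_d).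
Local Notation pr := (closest_point M).

Lemma tube_closest_point x : tube M tau%:E x ->
  [/\ M (pr x), Defs.normal_space M (pr x) (x - pr x) & enorm (x - pr x) < tau].
Proof.
move=> /(tubeP _ cM)[p [Mp]]; rewrite lte_fin => px.
have [Mq qmin] := closest_pointP _ cM x (ex_intro _ p Mp).
split=> //; first exact: minimizer_normal.
exact: le_lt_trans (qmin _ Mp) px.
Qed.

(** The new point is the same foot plus the normal vector scaled by [1 + s], of length below
    [2 * tau < r]. The value [s = 1] gives the doubled normal, small [s] the derivative along it. *)
Lemma closest_point_segment x s : tube M tau%:E x -> `|s| <= 1 ->
  pr (x + s *: (x - pr x)) = pr x.
Proof.
move=> /tube_closest_point[Mp np px] s1.
have -> : x + s *: (x - pr x) = pr x + (1 + s) *: (x - pr x).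
  by rewrite scalerDl scale1r addrA addrC [pr x + _]addrC subrK addrC.
apply: (closest_point_normal _ cM _ _ _ Mr Mp); first exact: normal_spaceZ.
rewrite lte_fin enormZ (le_lt_trans _ tau_r)// ler_pM ?enorm_ge0 ?(ltW px)//.
by rewrite (le_trans (ler_normD _ _))// normr1; lra.
Qed.

(* The ball of radius 2|x - pi(x)| around pi(x) + 2(x - pi(x)) contains no point
   of M in its interior. *)
Lemma normal_dotv_le x q : tube M tau%:E x -> M q ->
  4 * dotv (x - pr x) (q - pr x) <= enorm (q - pr x) ^+ 2.
Proof.
move=> xt Mq; have [Mp _ _] := tube_closest_point _ xt.
have [_] := closest_pointP _ cM (x + 1 *: (x - pr x)) (ex_intro _ q Mq).
move=> /(_ q Mq); rewrite closest_point_segment ?normr1// scale1r.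
set v := x - pr x; set w := q - pr x.
have -> : x + v - pr x = 2 *: v by rewrite addrAC -/v scaler_nat.
have -> : x + v - q = 2 *: v - w.
  by rewrite /v /w; apply/rowP => i; rewrite !mxE; ring.
move: v w => {xt Mq Mp} v w.
rewrite -(@ler_pXn2r _ 2) ?nnegrE ?enorm_ge0// !sqr_enorm !dotvE (dotvC w v).
lra.
Qed.

(** Write $a=\pi(x)$, $b=\pi(y)$. Adding [normal_dotv_le] for [x] against $b$ and for [y] against
    $a$ gives $\|a-b\|^2\le2\langle x-y,a-b\rangle$; Cauchy-Schwarz and cancellation finish. *)
Lemma closest_point_lipschitz x y : tube M tau%:E x -> tube M tau%:E y ->
  enorm (pr x - pr y) <= 2 * enorm (x - y).
Proof.
move=> xt yt; have [Mx _ _] := tube_closest_point _ xt.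
have [My _ _] := tube_closest_point _ yt.
have := normal_dotv_le _ _ xt My; have := normal_dotv_le _ _ yt Mx.
have := cauchy_schwarz (x - y) (pr x - pr y).
have := enorm_ge0 (x - y).
have [->|n0] := eqVneq (enorm (pr x - pr y)) 0; first by move=> *; rewrite mulr_ge0.
have {n0}n_gt0 : 0 < enorm (pr x - pr y) by rewrite lt_neqAle eq_sym n0 enorm_ge0.
rewrite (enormC (pr y)) => _ cs Hx Hy; rewrite -(ler_pM2r n_gt0) -mulrA -expr2.
move: cs Hx Hy; rewrite !sqr_enorm !dotvE.
rewrite !(dotvC (pr y) (pr x)).
lra.
Qed.

(** On the open tube of radius [r] the projection agrees with the base-point component [gp] of the
    inverse normal map, which is differentiable. *)
Lemma is_derive_closest_point x v i : tube M tau%:E x ->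
  is_derive x v (fun y => pr y 0 i) ((v *m (P0 M x)^T) 0 i).
Proof.
move=> xt; have [_ oT [gp [gv [gT /(_ i) [dgp _] _]]]] := Mr.
have xT : tube M r%:E x.
  have [Mp _ px] := tube_closest_point _ xt; apply/(tubeP _ cM); exists (pr x).
  by split=> //; rewrite lte_fin; move: px tau_r (enorm_ge0 (x - pr x)); lra.
have E : \forall y \near x, gp y 0 i = pr y 0 i.
  apply: filterS (open_nbhs_nbhs (conj oT xT)) => y /gT[[/= Mp np vr] yE]; rewrite -[in RHS]yE.
  by rewrite (closest_point_normal _ cM _ _ _ Mr Mp np vr).
have D u : is_derive x u (fun y => pr y 0 i) (dotv (grad (fun y => gp y 0 i) x) u).
  by apply: (near_eq_is_derive E); apply: is_derive_diff; exact: dgp.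
apply: is_derive_eq (D v) _; rewrite mxE; apply: eq_bigr => j _.
rewrite !mxE mulrC; congr (_ * _); rewrite /partial.
by apply: near_eq_derive; exact: E.
Qed.

Lemma tube_near x v : tube M tau%:E x ->
  \forall t \near (0 : R), tube M tau%:E (x + t *: v).
Proof.
move=> /tube_closest_point[Mp _ px].
(* Remaining slack divided by the speed; the [+ 1] keeps the denominator positive when [v = 0]. *)
have e0 : 0 < (tau - enorm (x - pr x)) / (enorm v + 1).
  by rewrite divr_gt0 ?subr_gt0// ltr_wpDl ?enorm_ge0.
have H : \forall t \near (0 : R), `|t| < (tau - enorm (x - pr x)) / (enorm v + 1).
  exact: nbhs0_lt.
apply: filterS H => t t1; apply/(tubeP _ cM); exists (pr x); split=> //; rewrite lte_fin.
rewrite addrAC (le_lt_trans (ler_enormD _ _))// -ltrBrDl enormZ.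
rewrite (@le_lt_trans _ _ (`|t| * (enorm v + 1)))//.
  by rewrite ler_wpM2l// lerDl.
by rewrite -ltr_pdivlMr// ltr_wpDl ?enorm_ge0.
Qed.

Lemma is_derive_closest_point_dotv x v w : tube M tau%:E x ->
  is_derive (0 : R) 1 (fun t : R => dotv (pr (x + t *: v)) w) (dotv (v *m (P0 M x)^T) w).
Proof.
move=> xt; apply/(is_derive_line0 (fun y => dotv (pr y) w)).
have -> : (fun y => dotv (pr y) w) = \sum_i (w 0 i *: (fun y => pr y 0 i)).
  by apply/funext => y; rewrite fct_sumE; apply: eq_bigr => i _; rewrite mulrC.
have H i := is_derive_closest_point _ v i xt.
apply: is_derive_eq; apply: eq_bigr => i _; exact: mulrC.
Qed.

Lemma P0_le2 x v : tube M tau%:E x -> enorm (v *m (P0 M x)^T) <= 2 * enorm v.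
Proof.
move=> xt; apply: enorm_ler_dotv => [|w]; first by rewrite mulr_ge0 ?enorm_ge0.
apply: le_trans (ler_norm _) _.
apply: (is_derive_le _ _ _ (is_derive_closest_point_dotv _ v w xt)).
near=> t.
have yt : tube M tau%:E (x + t *: v) by near: t; exact: tube_near.
rewrite scale0r addr0 -dotvNl -dotvDl (le_trans (ler_norm_dotv _ _))//.
rewrite [leRHS]mulrAC ler_wpM2r ?enorm_ge0//.
rewrite (le_trans (closest_point_lipschitz _ _ yt xt))//.
by rewrite (addrC x) addrK enormZ mulrA mulrAC.
Unshelve. all: by end_near. Qed.

Lemma P0_normal x : tube M tau%:E x -> (x - pr x) *m (P0 M x)^T = 0.
Proof.
move=> xt; apply: enorm_eq0; apply/eqP; rewrite eq_le enorm_ge0 andbT.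
apply: enorm_ler_dotv => [//|w]; rewrite mul0r.
apply: le_trans (ler_norm _) _.
apply: (is_derive_le _ _ _ (is_derive_closest_point_dotv _ _ w xt)).
(* For [t] near 0 the projection is constant on the normal segment, so [is_derive_le] applies with
   constant 0. *)
near=> t; rewrite scale0r addr0 closest_point_segment ?subrr ?normr0 ?mul0r//.
Unshelve. all: by end_near. Qed.

End Projection.

(** * Convolution with a probability measure *)

Section Convolution.
Context {R : realType} {d : nat}.
Variable mu : probability (borelV R d) R.
Implicit Types (phi psi : 'rV[R]_d -> R) (x v : 'rV[R]_d) (B : R).

(** [p_sigma mu sigma] is by unfolding the case [phi = gauss sigma]; other kernels give its
    derivatives. *)
Definition convol phi x : R := fine (\int[mu]_(y in setT) (phi (x - (y : 'rV[R]_d)))%:E)%E.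

Lemma continuous_borelV phi : continuous phi ->
  measurable_fun setT (phi : borelV R d -> R).
Proof.
move=> /continuousP cphi; apply: (measurability _ (RGenOpens.measurableE R)) => //.
move=> _ [_ [a [b ->] <-]]; rewrite setTI; apply: sub_sigma_algebra.
by apply: cphi; exact: interval_open.
Qed.

Lemma measurable_translate phi x : continuous phi ->
  measurable_fun setT (fun y : borelV R d => phi (x - (y : 'rV[R]_d))).
Proof.
move=> cphi; apply: (continuous_borelV (fun y => phi (x - y))).
suff : continuous (phi \o (fun y : 'rV[R]_d => x - y)) by [].
move=> y; apply: continuous_comp; last exact: cphi.
by apply: continuousB => //; exact: cst_continuous.
Qed.

Lemma integrable_translate phi x B : continuous phi -> (forall z, `|phi z| <= B) ->
  mu.-integrable setT (EFin \o (fun y : borelV R d => phi (x - (y : 'rV[R]_d)))).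
Proof.
move=> cphi phiB; apply: (@le_integrable _ _ _ mu _ measurableT _ (EFin \o cst B)).
- by apply/measurable_EFinP; exact: measurable_translate.
- by move=> y _ /=; rewrite lee_fin (le_trans (phiB _))// ler_norm.
- exact: finite_measure_integrable_cst.
Qed.

(** Differentiation under the integral along the line [x + t *: v], for [t] between -1 and 1; the
    constant [B'] dominates and is integrable for a probability measure. *)
Lemma is_derive_convol phi psi v B (B' : R) : continuous phi ->
  (forall z, `|phi z| <= B) -> (forall z, `|psi z| <= B') ->
  (forall z, is_derive z v phi (psi z)) ->
  forall x, is_derive x v (convol phi) (convol psi x).
Proof.
move=> cphi phiB psiB dphi x; apply/is_derive_line0.
pose g (t : R) (y : borelV R d) := phi (x + t *: v - (y : 'rV[R]_d)).
have dg (t : R) (y : borelV R d) : is_derive t 1 (g ^~ y) (psi (x + t *: v - (y : 'rV[R]_d))).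
  rewrite /g; have -> : (fun t => phi (x + t *: v - (y : 'rV[R]_d))) =
      (fun t => phi ((x - (y : 'rV[R]_d)) + t *: v)).
    by apply/funext => s; rewrite addrAC.
  by apply/is_derive_line; rewrite addrAC.
have I0 : `](-1), 1[%classic (0 : R) by rewrite /= in_itv /= ltrN10 ltr01.
have ig (t : R) : `](-1), 1[%classic t -> mu.-integrable setT (EFin \o g t).
  by move=> _; apply: integrable_translate cphi phiB.
have derg (t : R) (y : borelV R d) : `](-1), 1[%classic t -> setT y -> derivable (g ^~ y) t 1.
  by move=> _ _; have [] := dg t y.
have d1g (t : R) (y : borelV R d) : partial1of2 g t y = psi (x + t *: v - (y : 'rV[R]_d)).
  by rewrite partial1of2E; have [_ ->] := dg t y.
have B0 : 0 <= B' by exact: le_trans (normr_ge0 _) (psiB 0).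
have gB (t : R) (y : borelV R d) : `](-1), 1[%classic t -> setT y -> `|partial1of2 g t y| <= cst B' y.
  by move=> _ _; rewrite d1g.
have iB : mu.-integrable setT (EFin \o cst B') by exact: finite_measure_integrable_cst.
split; first exact: (derivable_under_integral measurableT I0 ig derg (fun=> B0) iB gB).
have := differentiation_under_integral measurableT I0 ig derg (fun=> B0) iB gB.
rewrite derive1E => ->; rewrite /convol /Rintegral; congr fine.
by apply: eq_integral => y _ /=; rewrite d1g scale0r addr0.
Qed.

(** A zero integral would make the positive integrand vanish almost everywhere, so the whole space
    would be null, against total mass 1. *)
Lemma convol_gt0 phi B : continuous phi -> (forall z, `|phi z| <= B) ->
  (forall z, 0 < phi z) -> forall x, 0 < convol phi x.
Proof.
move=> cphi phiB phi0 x.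
have mphi := measurable_translate _ x cphi.
have /integrableP[_ ioo] := integrable_translate _ x _ cphi phiB.
pose g (y : borelV R d) := phi (x - (y : 'rV[R]_d)).
pose J := (\int[mu]_(y in setT) (g y)%:E)%E.
have JE : J = (\int[mu]_(y in setT) `|(EFin \o g) y|)%E.
  by apply: eq_integral => y _ /=; rewrite gtr0_norm// /g.
have J0 : (0 <= J)%E by apply: integral_ge0 => y _; rewrite lee_fin; exact/ltW/phi0.
apply: fine_gt0; rewrite -/J; rewrite -JE in ioo; rewrite ioo andbT lt_neqAle J0 andbT eq_sym.
apply/negP => /eqP; rewrite JE => /ae_eq_integral_abs -/(_ measurableT).
case; first exact/measurable_EFinP.
move=> N [mN N0 sN].
have : (mu setT <= 0)%E.
  rewrite -N0; apply: le_measure; rewrite ?inE// => y _; apply: sN => /= /(_ I) [] /eqP.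
  by rewrite gt_eqF ?phi0.
by rewrite probability_setT lee_fin ler10.
Qed.

End Convolution.

(** * The Gaussian kernel *)

Section Gaussian.
Context {R : realType} {d : nat}.
Variable sigma : R.
Hypothesis sigma_gt0 : 0 < sigma.
Implicit Types (x v z : 'rV[R]_d).
Local Notation g := (@gauss R d sigma).

Lemma gauss_gt0 z : 0 < g z.
Proof.
rewrite /gauss mulr_gt0 ?expR_gt0// invr_gt0 exprn_gt0// mulr_gt0//.
by rewrite sqrtr_gt0 mulr_gt0// pi_gt0.
Qed.

(** With $t=\|z\|^2/(2\sigma^2)$, this is $1+2\sigma^2t\le(1+2\sigma^2)(1+t)\le(1+2\sigma^2)e^t$.
    The quadratic weight covers the polynomial factors of the first two derivatives. *)
Lemma gauss_bound z : (1 + enorm z ^+ 2) * g z <=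
  (Num.sqrt (2 * pi) * sigma) ^- d * (1 + 2 * sigma ^+ 2).
Proof.
rewrite /gauss mulrCA ler_wpM2l//.
  by rewrite invr_ge0 exprn_ge0// mulr_ge0 ?sqrtr_ge0// ltW.
have s2 : 0 < 2 * sigma ^+ 2 by rewrite mulr_gt0// exprn_gt0.
set t := enorm z ^+ 2 / (2 * sigma ^+ 2).
have t0 : 0 <= t by rewrite divr_ge0 ?exprn_ge0 ?enorm_ge0// ltW.
have -> : enorm z ^+ 2 = t * (2 * sigma ^+ 2) by rewrite divfK// gt_eqF.
rewrite mulNr mulfK ?gt_eqF// expRN ler_pdivrMr ?expR_gt0//.
have := expR_ge1Dx t; nra.
Qed.

Lemma is_derive_gauss z v : is_derive z v g (- (dotv z v / sigma ^+ 2) * g z).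
Proof.
have dq : is_derive z v (fun y : 'rV[R]_d => dotv y y) (2 * dotv z v).
  have -> : (fun y : 'rV[R]_d => dotv y y) =
      \sum_i ((fun y : 'rV[R]_d => y 0 i) * (fun y : 'rV[R]_d => y 0 i)).
    by apply/funext => y; rewrite fct_sumE.
  have H i := is_derive_coord z v i.
  apply: is_derive_eq; rewrite /dotv mulr_sumr; apply: eq_bigr => i _.
  by rewrite /GRing.scale /=; ring.
have -> : g = (Num.sqrt (2 * pi) * sigma) ^- d *:
    (expR \o (- (2 * sigma ^+ 2)^-1 *: (fun y : 'rV[R]_d => dotv y y))).
  apply/funext => y; rewrite /gauss sqr_enorm; congr (_ * expR _).
  by rewrite mulNr mulrC -mulNr.
have := is_derive_comp_real expR (- (2 * sigma ^+ 2)^-1 *: (fun y : 'rV[R]_d => dotv y y)) z v.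
move=> /(_ _ _ (is_derive_expR _) (is_deriveZ _ _)) H.
apply: is_derive_eq.
have s0 : sigma != 0 by rewrite gt_eqF.
rewrite /= /GRing.scale /=.
move: (_ ^- d) (expR _) (dotv z v) => K E D; rewrite -[K *: E]/(K * E).
by field.
Qed.

Lemma gauss_continuous : continuous g.
Proof.
move=> z; pose K : R := (Num.sqrt (2 * pi) * sigma) ^- d.
have -> : g = cst K * (expR \o (cst (- (2 * sigma ^+ 2)^-1) * (fun y : 'rV[R]_d => dotv y y))).
  apply/funext => y; rewrite /gauss sqr_enorm /= mulNr mulrC -mulNr.
  by rewrite /K [RHS]mulrC mulNr [dotv _ _ / _]mulrC -mulNr.
apply: continuousM; first exact: cst_continuous.
apply: continuous_comp; last exact: continuous_expR.
by apply: continuousM; [exact: cst_continuous|exact: dotv_continuous].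
Qed.

(** First partial derivatives of the Gaussian kernel, followed by the second ones. *)
Definition gauss_d1 i z : R := - (z 0 i / sigma ^+ 2) * g z.
Definition gauss_d2 i j z : R :=
  (z 0 i * z 0 j / sigma ^+ 4 - (i == j)%:R / sigma ^+ 2) * g z.

Lemma dotv_evec z i : dotv z (evec i) = z 0 i.
Proof.
rewrite /dotv (bigD1 i)//= big1 => [|j ji]; rewrite mxE /= ?eqxx ?(negbTE ji) ?mulr1 ?addr0//.
by rewrite mulr0.
Qed.

Lemma is_derive_gauss_evec i z : is_derive z (evec i) g (gauss_d1 i z).
Proof. by have := is_derive_gauss z (evec i); rewrite dotv_evec. Qed.

Lemma is_derive_gauss_d1 i j z : is_derive z (evec j) (gauss_d1 i) (gauss_d2 i j z).
Proof.
have -> : gauss_d1 i = (- (sigma ^+ 2)^-1 *: (fun y : 'rV[R]_d => y 0 i)) * g.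
  by apply/funext => y; rewrite /gauss_d1 mulrC [RHS]mulrC; congr (_ * _); rewrite mulrC -mulNr.
have H1 := is_derive_coord z (evec j) i; have H2 := is_derive_gauss_evec j z.
apply: is_derive_eq; rewrite /gauss_d2 /gauss_d1 mxE eqxx andTb.
have s0 : sigma != 0 by rewrite gt_eqF.
move: ((i == j)%:R : R) (g z) => b G; rewrite -[(_ *: _) z]/(- sigma ^- 2 * z 0 i).
rewrite -[_ + _]/(- sigma ^- 2 * z 0 i * (- (z 0 j / sigma ^+ 2) * G) + G * (- sigma ^- 2 * b)).
by field.
Qed.

Lemma gauss_d1_continuous i : continuous (gauss_d1 i).
Proof.
move=> z; apply: (@continuousM _ _ (fun z => - (z 0 i / sigma ^+ 2)) g); last exact: gauss_continuous.
apply: continuousN; apply: continuousM; last exact: cst_continuous.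
exact: coord_continuous.
Qed.

Lemma gauss_bounded : exists B, [/\ forall z, `|g z| <= B,
  forall i z, `|gauss_d1 i z| <= B & forall i j z, `|gauss_d2 i j z| <= B].
Proof.
(* [A] dominates the coefficients 1, $\sigma^{-2}$ and $\sigma^{-4}$ in the polynomial factors of
   the kernel and its derivatives; [K] is the bound of [gauss_bound]. *)
pose K := (Num.sqrt (2 * pi) * sigma) ^- d * (1 + 2 * sigma ^+ 2).
pose s := (sigma ^+ 2)^-1; pose A := 1 + s + s ^+ 2.
have s0 : 0 < s by rewrite invr_gt0 exprn_gt0.
have A0 : 0 <= A by rewrite /A; nra.
have gK z a : `|a| <= A * (1 + enorm z ^+ 2) -> `|a * g z| <= A * K.
  move=> aA; rewrite normrM (gtr0_norm (gauss_gt0 z)).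
  rewrite (le_trans (ler_wpM2r (ltW (gauss_gt0 z)) aA))// -mulrA ler_wpM2l//.
  exact: gauss_bound.
have z1 z i : `|z 0 i| <= 1 + enorm z ^+ 2.
  rewrite (le_trans (ler_coord_enorm z i))//; have := enorm_ge0 z; nra.
exists (A * K); split=> [z|i z|i j z].
- by rewrite -[g z]mul1r; apply: gK; rewrite normr1; have := sqr_ge0 (enorm z); rewrite /A; nra.
- apply: gK; rewrite normrN normrM (gtr0_norm s0) -/s.
  have := z1 z i; have := normr_ge0 (z 0 i); have := sqr_ge0 (enorm z).
  move: (enorm z ^+ 2) `|z 0 i| => e a e0 a0 ae.
  rewrite mulrC (le_trans (ler_wpM2l (ltW s0) ae))// ler_wpM2r ?addr_ge0//.
  by rewrite /A; nra.
- apply: gK; rewrite (le_trans (ler_normB _ _))// !normrM (gtr0_norm s0) -/s.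
  have -> : `|(sigma ^+ 4)^-1| = s ^+ 2.
    by rewrite ger0_norm ?invr_ge0 ?exprn_ge0 ?ltW// /s exprVn -exprM.
  have zz : `|z 0 i| * `|z 0 j| <= enorm z ^+ 2.
    by rewrite expr2 ler_pM// ler_coord_enorm.
  have b1 : `|(i == j)%:R : R| <= 1 by case: (i == j); rewrite ?normr1 ?normr0.
  have := ler_wpM2r (sqr_ge0 s) zz; have := ler_wpM2r (ltW s0) b1.
  have := sqr_ge0 (enorm z); rewrite /A; move: (enorm z ^+ 2) => e e0.
  have := mulr_ge0 (ltW s0) e0; have := sqr_ge0 s; lra.
Qed.

End Gaussian.

(** * The gradient of the objective *)

Section Objective.
Context {R : realType} {d : nat}.
Variables (mu : probability (borelV R d) R) (sigma : R).
Hypothesis sigma_gt0 : 0 < sigma.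
Implicit Types (x v z : 'rV[R]_d).
Local Notation p := (p_sigma mu sigma).
Local Notation lnp := (fun y => ln (p y)).

Lemma p_sigma_gt0 x : 0 < p x.
Proof.
have [B [gB _ _]] := @gauss_bounded R d sigma sigma_gt0.
exact: (convol_gt0 mu (gauss sigma) B (gauss_continuous _) gB (gauss_gt0 sigma sigma_gt0)).
Qed.

Lemma is_derive_p_sigma x i :
  is_derive x (evec i) p (convol mu (gauss_d1 sigma i) x).
Proof.
have [B [gB g1B _]] := @gauss_bounded R d sigma sigma_gt0.
exact: (is_derive_convol mu _ _ _ B B (gauss_continuous _) gB (g1B i)
  (is_derive_gauss_evec sigma sigma_gt0 i)).
Qed.

Lemma is_derive_p_sigma_d1 x i j : is_derive x (evec j)
  (convol mu (gauss_d1 sigma i)) (convol mu (gauss_d2 sigma i j) x).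
Proof.
have [B [_ g1B g2B]] := @gauss_bounded R d sigma sigma_gt0.
exact: (is_derive_convol mu _ _ _ B B (gauss_d1_continuous _ i) (g1B i) (g2B i j)
  (is_derive_gauss_d1 sigma sigma_gt0 i j)).
Qed.

Lemma is_derive_ln_p_sigma x i :
  is_derive x (evec i) lnp ((p x)^-1 * convol mu (gauss_d1 sigma i) x).
Proof.
exact: (is_derive_comp_real _ _ _ _ _ _ (is_derive1_ln (p_sigma_gt0 x))
  (is_derive_p_sigma x i)).
Qed.

Lemma partial_ln_p_sigma i :
  partial i lnp = (fun x => (p x)^-1) * convol mu (gauss_d1 sigma i).
Proof. by apply/funext => x; rewrite /partial; have [_ ->] := is_derive_ln_p_sigma x i. Qed.

(** Product rule with a nonvanishing density; the entries of [hessian] are therefore genuine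
    derivatives. *)
Lemma derivable_partial_ln_p_sigma x i j : derivable (partial i lnp) x (evec j).
Proof.
rewrite partial_ln_p_sigma; apply: derivableM.
  apply: derivableV; first by rewrite gt_eqF ?p_sigma_gt0.
  by have [] := is_derive_p_sigma x j.
by have [] := is_derive_p_sigma_d1 x i j.
Qed.

(** The identity contributes [1%:M], the scaled gradient of the log-density contributes the
    Hessian. *)
Lemma is_derive_pi_sigma x i j :
  is_derive x (evec j) (fun y => pi_sigma mu sigma y 0 i) (P_sigma mu sigma x i j).
Proof.
have -> : (fun y => pi_sigma mu sigma y 0 i) =
    (fun y : 'rV[R]_d => y 0 i) + sigma ^+ 2 *: partial i lnp.
  by apply/funext => y; rewrite /pi_sigma !mxE.
have H1 := is_derive_coord x (evec j) i.
have H2 := derivableP (derivable_partial_ln_p_sigma x i j).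
apply: (is_derive_eq (is_deriveD H1 (is_deriveZ (sigma ^+ 2) H2))); rewrite /P_sigma !mxE eqxx andTb eq_sym.
by rewrite -[sigma ^+ 2 *: _]/(sigma ^+ 2 * _).
Qed.

(** The chain rule gives $P_\sigma^T\nabla f$, which on rows is right multiplication by [P_sigma];
    and $-\sigma^2\nabla\log p_\sigma(x)=x-\pi_\sigma(x)$. *)
Lemma grad_F_sigma_eta (f : 'rV[R]_d -> R) (eta : R) x :
  differentiable f (pi_sigma mu sigma x) ->
  grad (F_sigma_eta mu f sigma eta) x =
  grad f (pi_sigma mu sigma x) *m P_sigma mu sigma x + eta *: (x - pi_sigma mu sigma x).
Proof.
move=> df; apply/rowP => j; rewrite mxE /partial.
have H1 : is_derive x (evec j) (f \o pi_sigma mu sigma)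
    (dotv (grad f (pi_sigma mu sigma x)) (col j (P_sigma mu sigma x))^T).
  apply: is_derive_chain => // i.
  have -> : (col j (P_sigma mu sigma x))^T 0 i = P_sigma mu sigma x i j by rewrite 2!mxE.
  exact: is_derive_pi_sigma.
have [dln _] := is_derive_ln_p_sigma x j.
have H2 := derivableP dln.
have -> : F_sigma_eta mu f sigma eta =
    (f \o pi_sigma mu sigma) + (eta * - sigma ^+ 2) *: lnp.
  by apply/funext => y; rewrite /F_sigma_eta /d_sigma mulrA.
have [_ ->] := is_deriveD H1 (is_deriveZ (eta * - sigma ^+ 2) H2).
rewrite mxE; congr (_ + _); rewrite mxE.
  by rewrite /dotv; apply: eq_bigr => i _; rewrite [_^T _ _]mxE [col _ _ _ _]mxE.
rewrite -[LHS]/(eta * - sigma ^+ 2 * partial j lnp x) !mxE.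
by ring.
Qed.

End Objective.

(** * The descent step *)

(** Both denominators are positive, so the minimum splits into two division-free bounds. *)
Lemma gamma_tubular_le {R : realType} (C eps tau eta gam : R) :
  0 <= C -> 0 < eps -> 0 < tau -> 0 < eta -> gam <= gamma_tubular C eps tau eta ->
  gam * (2 * (C * (eps + 2) + 2 * eta * tau)) <= tau /\
  gam * (4 * (C * (eps + 4) + 3 * eta * tau) ^+ 2) <=
    tau * (eta * tau / 4 - (C + eta) * eps / 2).
Proof.
move=> C0 eps0 tau0 eta0; have et := mulr_gt0 eta0 tau0.
have Ce (k : R) : 0 < k -> 0 <= C * (eps + k) by move=> k0; rewrite mulr_ge0// addr_ge0// ltW.
have D1 : 0 < 2 * (C * (eps + 2) + 2 * eta * tau) by have := Ce 2 (ltr0n _ 2); lra.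
have D2 : 0 < 4 * (C * (eps + 4) + 3 * eta * tau) ^+ 2.
  apply: mulr_gt0 => //; apply: exprn_gt0.
  have := Ce 4 (ltr0n _ 4); lra.
rewrite /gamma_tubular minr_pMr ?(ltW tau0)// le_min => /andP[].
by rewrite mul1r [tau * (_ / _)]mulrA !ler_pdivlMr.
Qed.

Lemma descent_step {R : realType} {d : nat} (u G : 'rV[R]_d) (C eps tau eta gam : R) :
  0 <= C -> 0 < eps -> 0 < tau -> 0 < eta -> eps * (2 * (C + eta)) <= eta * tau ->
  0 <= gam -> gam <= gamma_tubular C eps tau eta ->
  enorm u < tau -> enorm G <= C * (eps + 2) + eta * (enorm u + eps) ->
  enorm u * (eta * enorm u - (C + eta) * eps) <= dotv u G ->
  enorm (u - gam *: G) < tau.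
Proof.
move=> C0 eps0 tau0 eta0 epsle gam0 /gamma_tubular_le -/(_ C0 eps0 tau0 eta0)[gam1 gam2].
have u0 := enorm_ge0 u; have G0 := enorm_ge0 G.
have Ceps : 0 <= C * eps by rewrite mulr_ge0// ltW.
have eps2 : eps <= tau / 2 by rewrite -(ler_pM2l eta0); lra.
have et := mulr_gt0 eta0 tau0.
move=> utau Gle uG.
have [ur|ru] := ltP (enorm u) (tau / 2).
  (* Inner half of the tube: a step of length at most [tau / 2] cannot leave it. *)
  rewrite (le_lt_trans (ler_enormB _ _))// enormZ ger0_norm//.
  have GD : enorm G <= C * (eps + 2) + 2 * eta * tau.
    rewrite (le_trans Gle)// lerD2l; have := ler_wpM2l (ltW eta0) (lerD (ltW ur) eps2).
    by lra.
  have := ler_wpM2l gam0 GD; lra.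
(* The ingredients of the second bound in [gamma_tubular], which reads
   [gam * (4 * H ^+ 2) <= tau * A]. *)
pose H := C * (eps + 4) + 3 * eta * tau; pose A := eta * tau / 4 - (C + eta) * eps / 2.
have GH : enorm G <= H.
  rewrite (le_trans Gle)// /H; have := ler_wpM2l (ltW eta0) (lerD (ltW utau) eps2).
  by lra.
have A0 : 0 <= A by rewrite /A; lra.
(* The factor $\|u\|$ is at least [tau / 2] and the other factor at least [2 * A]. *)
have uGA : tau * A <= dotv u G.
  apply: le_trans uG.
  have : 2 * A <= eta * enorm u - (C + eta) * eps.
    by rewrite /A; have := ler_wpM2l (ltW eta0) ru; lra.
  move=> A2; have := ler_pM (ltW (divr_gt0 tau0 (ltr0n _ 2))) (mulr_ge0 (ler0n _ 2) A0) ru A2.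
  by lra.
have GG : enorm G ^+ 2 <= H ^+ 2 by rewrite ler_pXn2r ?nnegrE// (le_trans G0).
rewrite -(@ltr_pXn2r _ 2) ?nnegrE ?enorm_ge0 ?(ltW tau0)//.
apply: (@le_lt_trans _ _ (enorm u ^+ 2)); last by rewrite ltr_pXn2r ?nnegrE ?(ltW tau0).
rewrite (sqr_enorm (u - gam *: G)) !dotvE (dotvC G u) -!sqr_enorm.
(* In the expansion of $\|u-\gamma G\|^2$ the quadratic term is at most $\gamma\tau A/4$, while the
   cross term subtracts at least $2\gamma\tau A$. *)
have gGG := ler_wpM2l gam0 (ler_wpM2l gam0 GG).
have gHA := ler_wpM2l gam0 gam2; rewrite -/H -/A in gHA.
have guA := ler_wpM2l gam0 uGA.
have tA : 0 <= gam * (tau * A) by rewrite !mulr_ge0 ?(ltW tau0).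
move: (enorm u ^+ 2) (dotv u G) (enorm G ^+ 2) (H ^+ 2) (tau * A) gGG gHA guA tA => *.
lra.
Qed.

Theorem theorem8 (R : realType) (d : nat) (M : set 'rV[R]_d)
  (mu : probability (borelV R d) R) (f : 'rV[R]_d -> R) (C eta tau sigma eps : R)
  (gamma : nat -> R) (x : nat -> 'rV[R]_d) :
  compact M -> C2_submanifold M -> (0 < reach M)%E ->
  mu (~` M) = 0%E ->
  C1_on setT f ->
  ereal_sup [set (enorm (grad f y))%:E | y in tube M (reach M)] = C%:E ->
  0 < eta ->
  0 < tau -> ((2 * tau)%:E < reach M)%E ->
  0 < sigma ->
  0 < eps -> eps <= eta * tau / (2 * (C + eta)) ->
  (forall y, tube M tau%:E y ->
     enorm (pi_sigma mu sigma y - closest_point M y) < eps /\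
     opnorm (P_sigma mu sigma y - P0 M y) < eps) ->
  (forall k, 0 <= gamma k <= gamma_tubular C eps tau eta) ->
  tube M tau%:E (x 0%N) ->
  (forall k, x k.+1 = x k - gamma k *: grad (F_sigma_eta mu f sigma eta) (x k)) ->
  forall k, tube M tau%:E (x k).
Proof.
move=> cM _ _ _ [df _] supC eta0 tau0 tau2 sigma0 eps0 epsle close gam x0 xS.
have gradC y : tube M (reach M) y -> enorm (grad f y) <= C.
  by move=> yt; rewrite -lee_fin -supC; apply: ereal_sup_ubound; exists y.
have tau_reach : (tau%:E < reach M)%E by apply: le_lt_trans tau2; rewrite lee_fin; lra.
(* The initial point lies in the tube, so [C] dominates at least one norm. *)
have C0 : 0 <= C.
  apply: le_trans (enorm_ge0 _) (gradC (x 0%N) _).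
  have /(tubeP _ cM)[p [Mp pt]] := x0.
  by apply/(tubeP _ cM); exists p; split=> //; exact: lt_trans pt tau_reach.
have Ceta : 0 < 2 * (C + eta) by lra.
rewrite ler_pdivlMr// in epsle.
(* The reach is a supremum, so some radius above [2 * tau] already makes the normal map a
   diffeomorphism. *)
have [_ [r [_ Mr] <-]] := ereal_sup_gt tau2; rewrite lte_fin => tau_r.
elim=> // k xt; rewrite xS; move: (gam k) => /andP[gam0 gam_le] {xS gam x0}.
move: (x k) (gamma k) xt gam0 gam_le => {gamma}y g yt g0 g_le {x k}.
have [Mp _ py] := tube_closest_point _ _ cM y yt.
have [qp PP] := close y yt.
rewrite grad_F_sigma_eta//; last exact: df.
set p := closest_point M y in Mp py qp *; set q := pi_sigma mu sigma y in qp *.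
set A := P_sigma mu sigma y in PP *; set h := grad f q.
(* [q] is within [eps <= tau] of [p], a point of [M], hence in the tube where [C] bounds the
   gradient. *)
have hC : enorm h <= C.
  apply: gradC; apply/(tubeP _ cM); exists p; split=> //.
  apply: le_lt_trans tau_reach; rewrite lee_fin (le_trans (ltW qp))//.
  have Ceps : 0 <= C * eps by rewrite mulr_ge0// ltW.
  by rewrite -(ler_pM2l eta0); have := mulr_gt0 eta0 tau0; lra.
have AP v : enorm (v *m (A - P0 M y)^T) <= eps * enorm v.
  by rewrite (le_trans (opnorm_ub _ _))// ler_wpM2r ?enorm_ge0// ltW.
have Anorm v : enorm (v *m A^T) <= (eps + 2) * enorm v.
  rewrite -(subrK (P0 M y) A) linearD mulmxDr (le_trans (ler_enormD _ _))// mulrDl lerD//.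
  exact: (P0_le2 _ _ _ cM Mr tau_r).
(* Here [P0] annihilates the normal vector [y - p], so only the error [A - P0 M y] contributes. *)
have An : enorm ((y - p) *m A^T) <= eps * enorm (y - p).
  rewrite -(subrK (P0 M y) A) linearD mulmxDr.
  by rewrite (P0_normal _ _ _ cM Mr tau_r)// addr0.
have hA : enorm (h *m A) <= C * (eps + 2).
  apply: enorm_ler_dotv => [|v]; first by rewrite mulr_ge0// addr_ge0// ltW.
  rewrite dotvC -dotv_mulmx dotvC (le_trans (cauchy_schwarz _ _))// -mulrA.
  by rewrite ler_pM ?enorm_ge0.
have yq : y - q = (y - p) - (q - p) by rewrite opprB addrA subrK.
(* The old foot [p] serves as the nearby point of [M] for the new iterate. *)
apply/(tubeP _ cM); exists p; split=> //; rewrite lte_fin addrAC.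
apply: (descent_step _ _ C eps tau eta) => //.
- rewrite (le_trans (ler_enormD _ _))// lerD// enormZ gtr0_norm// ler_wpM2l ?(ltW eta0)//.
  by rewrite yq (le_trans (ler_enormB _ _))// lerD2l ltW.
(* With $u=y-p$ the product is $\langle Au,h\rangle+\eta\|u\|^2-\eta\langle u,q-p\rangle$; the outer
   terms are at least $-C\epsilon\|u\|$ and $-\eta\epsilon\|u\|$. *)
- rewrite yq !dotvDr dotvZr dotvDr dotvNr -sqr_enorm -dotv_mulmx.
  have n0 := enorm_ge0 (y - p).
  have := ler_norm_dotv ((y - p) *m A^T) h; rewrite ler_norml => /andP[b1 _].
  have b2 := ler_pM (enorm_ge0 _) (enorm_ge0 _) An hC.
  have b3 := cauchy_schwarz (y - p) (q - p).
  have b4 := ler_wpM2l n0 (ltW qp).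
  have b5 := ler_wpM2l (ltW eta0) (le_trans b3 b4).
  by lra.
Qed.
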